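(* For all integers $n\ge 0$ and all integers $k\ge j\ge 0$, \[ a_{3(k-j)+5,\;3k+1}(3n+2)\equiv 0 \pmod 3. \]
   Context: For positive integers $r,s$, $a_{r,s}(n)$ denotes the number of multicolored partitions of $n$ in which each even part may appear in one of $r$ colors and each odd part may appear in one of $s$ colors (copies of the same part size in different colors are distinct), with $a_{r,s}(0)=1$. Equivalently, for $|q|<1$, $\sum_{n\ge0}a_{r,s}(n)q^n = f_2^{s-r}/f_1^{s}$, where $f_m=\prod_{i\ge1}(1-q^{mi})$. *)

(* Defs.v *)
From mathcomp Require Import all_boot.
Set Implicit Arguments.
Unset Strict Implicit.
Unset Printing Implicit Defensive.

Definition ncolors (r s p : nat) : nat := if odd p then s else r.

(* The tagged pair (i, c) is the part i.+1 in color c; a part of a partition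
   of n is at most n. *)
Definition colored_part (r s n : nat) : finType :=
  {i : 'I_n & 'I_(ncolors r s i.+1)}.

Definition part_size (r s n : nat) (x : colored_part r s n) : nat := (tag x).+1.

(* A multicolored partition of n is given by the multiplicity m x of each
   colored part x; no multiplicity exceeds n since every part is positive. *)
Definition multicolored_partitions (r s n : nat) :
    {set {ffun colored_part r s n -> 'I_n.+1}} :=
  [set m : {ffun colored_part r s n -> 'I_n.+1} |
    \sum_(x : colored_part r s n) m x * part_size x == n].

Definition a (r s n : nat) : nat := #|multicolored_partitions r s n|.

Lemma a0 (r s : nat) : a r s 0 = 1.
Proof.
have e0 (x : colored_part r s 0) : False by case: x => [[]].
rewrite /a; suff -> : multicolored_partitions r s 0 = [set: _].
  rewrite cardsT card_ffun; suff -> : #|colored_part r s 0| = 0 by [].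
  by apply: eq_card0 => x; case: (e0 x).
apply/setP => m; rewrite !inE big1 // => x; case: (e0 x).
Qed.

(* Main.v *)
(** Let u_o, u_e be the products of 1 - q^i over the odd, resp. even, i.  Since
    f_1 = u_o u_e and f_2 = u_e, the generating function is
    u_o^-(3k+1) u_e^-(3(k-j)+5) = (u_o^-(k+1) u_e^-(k-j+2))^3 u_o^2 u_e, and by
    Gauss u_o^2 u_e = f_1^2 / f_2 is the sum of (-1)^m q^(m^2) over all integers
    m.  Modulo 3 the cube is a series in q^3, and a square is never 2 mod 3, so
    the coefficients at 3n+2 vanish.  Gauss's identity is obtained from a finite
    version in the style of Shanks, proved by telescoping; power series are
    handled as polynomials modulo q^(n+1). *)
Require Import Defs.
From mathcomp Require Import all_boot all_algebra.
From mathcomp Require Import ring zify.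
Import GRing.Theory.

Set Implicit Arguments.
Unset Strict Implicit.
Unset Printing Implicit Defensive.

Section GaussSquares.
Variable R : comNzRingType.
Local Open Scope ring_scope.
Implicit Types p q u v : {poly R}.

Definition eqX (n : nat) p q := exists h, p = q + 'X^n * h.

Lemma eqX_refl n p : eqX n p p.
Proof. by exists 0; rewrite mulr0 addr0. Qed.

Lemma eqX_sym n p q : eqX n p q -> eqX n q p.
Proof. by case=> h ->; exists (- h); ring. Qed.

Lemma eqX_trans n q p u : eqX n p q -> eqX n q u -> eqX n p u.
Proof. by case=> h -> [h' ->]; exists (h' + h); ring. Qed.

Lemma eqXM n p q u v : eqX n p q -> eqX n u v -> eqX n (p * u) (q * v).
Proof.
case=> h -> [h' ->]; exists (q * h' + h * v + 'X^n * h * h').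
ring.
Qed.

Lemma eqX_exp n m p q : eqX n p q -> eqX n (p ^+ m) (q ^+ m).
Proof.
move=> pq; elim: m => [|m IHm]; first exact: eqX_refl.
by rewrite !exprS; apply: eqXM.
Qed.

Lemma eqX_prod1 n (I : Type) (r : seq I) (P : pred I) (F : I -> {poly R}) :
  (forall i, P i -> eqX n (F i) 1) -> eqX n (\prod_(i <- r | P i) F i) 1.
Proof.
move=> F1; elim/big_rec: _ => [|i p Pi p1]; first exact: eqX_refl.
by rewrite -[1]mulr1; apply: eqXM => //; apply: F1.
Qed.

Lemma eqX_coef n p q i : (i < n)%N -> eqX n p q -> p`_i = q`_i.
Proof. by move=> lt_in [h ->]; rewrite coefD coefXnM lt_in addr0. Qed.

Lemma eqX_1subXn n m : (n <= m)%N -> eqX n (1 - 'X^m : {poly R}) 1.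
Proof. by move=> le_nm; exists (- 'X^(m - n)); rewrite mulrN -exprD subnKC. Qed.

(** The theta series of (-1)^m q^(m^2) over -n <= m <= n; pairing m with -m gives the factor 2. *)
Definition gauss_sum n : {poly R} :=
  1 + \sum_(1 <= i < n.+1) 2%:R * (-1) ^+ i * 'X^(i ^ 2).

Lemma gauss_sum_coef n i :
  (forall m, i <> m ^ 2)%N -> (gauss_sum n)`_i = 0.
Proof.
move=> nsq; rewrite coefD coef1 coef_sum.
have /eqP/negbTE -> : i <> 0 by move=> i0; apply: (nsq 0); rewrite i0.
rewrite add0r big1 // => m _.
have -> : (2%:R * (-1) ^+ m : {poly R}) = (2%:R * (-1) ^+ m)%:P.
  by rewrite polyCM rmorphXn rmorphN rmorph1 polyC_natr.
have /eqP/negbTE E := nsq m.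
by rewrite coefCM coefXn E mulr0.
Qed.

(* For s > 0 the term is divisible by 'X^(n.+1); s = 0 gives the product in
   Gauss's identity. *)
Definition shanks_term n s : {poly R} :=
  (-1) ^+ s * 'X^(s * n.+1) * \prod_(s.+1 <= i < n.+1) (1 - 'X^i)
    * \prod_(0 <= i < s) (1 + 'X^i).

(** Induction on [n]: up to a telescoping difference, each term gets multiplied by [1 + 'X^(n.+1)],
    and the boundary terms supply the new square. *)
Lemma shanks_identity n :
  \prod_(1 <= i < n.+1) (1 + 'X^i) * gauss_sum n
    = \sum_(0 <= s < n.+1) shanks_term n s.
Proof.
elim: n => [|n IHn].
  rewrite /gauss_sum /shanks_term !(big_geq (leqnn 1)) big_nat1 mul0n !big_geq //.
  by rewrite !expr0; ring.
(* Telescoping certificate: for [s <= n], [T s] is [(1 - 'X^s) * shanks_term n s]. *)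
pose T s : {poly R} := (-1) ^+ s * 'X^(s * n.+1)
  * \prod_(s <= i < n.+1) (1 - 'X^i) * \prod_(0 <= i < s) (1 + 'X^i).
have step s : (s < n.+1)%N ->
    shanks_term n.+1 s = (1 + 'X^(n.+1)) * shanks_term n s + (T s.+1 - T s).
  move=> lt_sn; rewrite /shanks_term /T [\prod_(s <= i < n.+1) _]big_ltn //.
  rewrite [\prod_(s.+1 <= i < n.+2) _]big_nat_recr //=.
  rewrite [\prod_(0 <= i < s.+1) _]big_nat_recr //=.
  have -> : (s * n.+2 = s * n.+1 + s)%N by lia.
  have -> : (s.+1 * n.+1 = s * n.+1 + n.+1)%N by lia.
  rewrite !exprD [(-1) ^+ s.+1]exprS.
  by ring.
rewrite [RHS]big_nat_recr //=.
rewrite (@eq_big_nat _ _ _ 0%N n.+1 (shanks_term n.+1) (fun s =>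
  (1 + 'X^(n.+1)) * shanks_term n s + (T s.+1 - T s))); last first.
  by move=> s /andP[_ lt_sn]; exact: step.
rewrite big_split -big_distrr /= -IHn telescope_sumr //.
have -> : T 0 = 0 by rewrite /T big_ltn // expr0 subrr mul0r mulr0 mul0r.
rewrite /gauss_sum [\sum_(1 <= i < n.+2) _]big_nat_recr //=.
rewrite [\prod_(1 <= i < n.+2) _]big_nat_recr //=.
(* The factor [1 + 'X^0] split off here is the 2 in the new term of [gauss_sum]. *)
rewrite /T /shanks_term !(big_geq (leqnn _)) [\prod_(0 <= i < n.+1) _]big_ltn //= expr0.
have -> : (n.+1 * n.+2 = n.+1 ^ 2 + n.+1)%N by lia.
rewrite mulnn exprD; ring.
Qed.

Lemma gauss_identity n :
  eqX n.+1 (\prod_(1 <= i < n.+1) (1 + 'X^i) * gauss_sum n)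
    (\prod_(1 <= i < n.+1) (1 - 'X^i)).
Proof.
rewrite shanks_identity [\sum_(_ <= _ < _) _]big_ltn // /shanks_term expr0 mul0n [X in _ * X]big_geq //.
exists (\sum_(1 <= s < n.+1) (-1) ^+ s * 'X^(s.-1 * n.+1)
  * \prod_(s.+1 <= i < n.+1) (1 - 'X^i) * \prod_(0 <= i < s) (1 + 'X^i)).
rewrite expr0 !mul1r mulr1; congr (_ + _).
rewrite big_distrr; apply: eq_big_nat => -[|s] //= _.
by rewrite mulSn exprD; ring.
Qed.

(** Truncates u_o for [P := odd] and u_e for [P := predC odd]. *)
Definition poch (P : pred nat) n : {poly R} :=
  \prod_(1 <= i < n.+1 | P i) (1 - 'X^i).

Lemma poch_even_double n :
  poch (predC odd) n.*2 = \prod_(1 <= i < n.+1) (1 - 'X^(i.*2)).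
Proof.
rewrite /poch; elim: n => [|n IHn]; first by rewrite !big_geq.
rewrite [RHS]big_nat_recr //= -IHn doubleS big_mkcond big_nat_recr //=.
by rewrite big_nat_recr //= odd_double /= mulr1 -big_mkcond.
Qed.

Lemma poch_trunc P n m : (n <= m)%N -> eqX n.+1 (poch P m) (poch P n).
Proof.
move=> le_nm; rewrite /poch (big_cat_nat (n := n.+1)) //=.
rewrite -[X in eqX _ _ X]mulr1; apply: eqXM; first exact: eqX_refl.
rewrite big_nat_cond; apply: eqX_prod1 => i /andP[/andP[le_ni _] _].
exact: eqX_1subXn.
Qed.

Lemma poch_predC P n :
  \prod_(1 <= i < n.+1) (1 - 'X^i) = poch P n * poch (predC P) n.
Proof. by rewrite (bigID P). Qed.

(** Truncation of 1/(1 - q^i); [m] ranges over ['I_n.+1], the type of multiplicities in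
    [multicolored_partitions]. *)
Definition geom n i : {poly R} := \sum_(m < n.+1) 'X^(m * i).

Lemma geomK n i : (0 < i)%N -> eqX n.+1 (geom n i * (1 - 'X^i)) 1.
Proof.
move=> i_gt0.
have -> : geom n i * (1 - 'X^i) = 1 - 'X^(n.+1 * i).
  rewrite /geom; elim: n => [|n IHn]; first by rewrite big_ord1 mul0n mul1n mul1r.
  rewrite big_ord_recr /= mulrDl IHn [in RHS]mulSnr exprD; ring.
by apply: eqX_1subXn; rewrite leq_pmulr.
Qed.

Definition geom_prod (P : pred nat) n : {poly R} :=
  \prod_(1 <= i < n.+1 | P i) geom n i.

Lemma geom_prodK P n : eqX n.+1 (geom_prod P n * poch P n) 1.
Proof.
rewrite -big_split big_nat_cond; apply: eqX_prod1 => i /andP[/andP[i_gt0 _] _].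
exact: geomK.
Qed.

(** Since (1 - q^i)(1 + q^i) = 1 - q^(2i), multiplying the left side by u_e gives the even factors
    up to 2n, which are u_e again modulo q^(n+1); then u_e is cancelled by its inverse [ge]. *)
Lemma euler_odd_distinct n :
  eqX n.+1 (poch odd n * \prod_(1 <= i < n.+1) (1 + 'X^i)) 1.
Proof.
set D := \prod_(_ <= _ < _) _; set ge := geom_prod (predC odd) n.
set ue := poch (predC odd) n.
have geK : eqX n.+1 (ge * ue) 1 by apply: geom_prodK.
have double : eqX n.+1 (poch odd n * D * ue) ue.
  have -> : poch odd n * D * ue = poch (predC odd) n.*2.
    rewrite poch_even_double mulrAC -poch_predC -big_split.
    by apply: eq_bigr => i _; rewrite /= -addnn exprD; ring.
  by apply: poch_trunc; rewrite -addnn leq_addr.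
apply: (eqX_trans (q := poch odd n * D * (ge * ue))).
  rewrite -[X in eqX _ X _]mulr1.
  by apply: eqXM; [exact: eqX_refl | exact: eqX_sym].
apply: eqX_trans geK; rewrite mulrCA.
by apply: eqXM; [exact: eqX_refl | exact: double].
Qed.

(** The product of the 1 + q^i inverts u_o, so Gauss's identity multiplied by u_o isolates the sum
    of squares. *)
Lemma gauss_product n :
  eqX n.+1 (gauss_sum n) (poch odd n ^+ 2 * poch (predC odd) n).
Proof.
rewrite expr2 -mulrA -poch_predC.
apply: (eqX_trans (q := poch odd n * \prod_(1 <= i < n.+1) (1 + 'X^i)
                          * gauss_sum n)).
  rewrite -[X in eqX _ X _]mul1r; apply: eqXM; last exact: eqX_refl.
  exact/eqX_sym/euler_odd_distinct.
by rewrite -mulrA; apply: eqXM; [exact: eqX_refl | exact: gauss_identity].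
Qed.

Lemma colored_prodE r s n :
  \prod_(x : colored_part r s n) geom n (part_size x)
    = geom_prod odd n ^+ s * geom_prod (predC odd) n ^+ r.
Proof.
transitivity (\prod_(i < n) geom n i.+1 ^+ ncolors r s i.+1).
  rewrite -(sig_big_dep (J := fun i : 'I_n => 'I_(ncolors r s i.+1)) predT
    (fun _ => predT) (fun i _ => geom n i.+1)) /=.
  by apply: eq_bigr => i _; rewrite prodr_const card_ord.
rewrite /geom_prod -!prodrXl (big_mkcond odd) (big_mkcond (predC odd)) -big_split /=.
rewrite big_add1 big_mkord; apply: eq_bigr => i _.
by rewrite /ncolors /=; case: (odd i); rewrite /= ?mulr1 ?mul1r.
Qed.

(** Expanding the product over colored parts gives one monomial per multiplicity function, with the
    size of the partition as exponent. *)
Lemma a_coef r s n :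
  (a r s n)%:R = (geom_prod odd n ^+ s * geom_prod (predC odd) n ^+ r)`_n :> R.
Proof.
rewrite -colored_prodE /geom bigA_distr_bigA coef_sum /a -sum1_card natr_sum.
rewrite big_mkcond /=; apply: eq_bigr => m _.
by rewrite -expr_sum coefXn inE eq_sym; case: eqP.
Qed.

End GaussSquares.

Local Open Scope ring_scope.

(** Frobenius is additive, so [q ^+ p] is a combination of the ['X^(k * p)]. *)
Lemma coef_exp_pchar (R : comNzRingType) (p : nat) (q : {poly R}) i :
  p \in [pchar R] -> ~~ (p %| i)%N -> (q ^+ p)`_i = 0.
Proof.
move=> pcharR ndvd.
have pcharP : p \in [pchar {poly R}] by rewrite pchar_poly.
rewrite -[q]coefK poly_def -(pFrobenius_autE pcharP) rmorph_sum coef_sum big1 //.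
move=> k _; rewrite /= pFrobenius_autE exprZn -exprM coefZ coefXn.
case: eqP => [E|]; last by rewrite mulr0.
by rewrite E dvdn_mull in ndvd.
Qed.

Lemma sqr_mod3 m : (m ^ 2 %% 3 != 2)%N.
Proof.
rewrite -modnXm; have := ltn_pmod m (isT : 0 < 3)%N.
by case: (m %% 3)%N => [|[|[|]]].
Qed.

Lemma coef_cube_gauss_sum (R : comNzRingType) (q : {poly R}) n i :
  3 \in [pchar R] -> (i %% 3 = 2)%N -> (q ^+ 3 * gauss_sum R n)`_i = 0.
Proof.
move=> char3 i2; rewrite coefM big1 // => -[k /= lt_ki] _.
have [dvd3|ndvd3] := boolP (3 %| k)%N; last first.
  by rewrite coef_exp_pchar // mul0r.
rewrite gauss_sum_coef ?mulr0 // => m Em.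
have := sqr_mod3 m; rewrite -Em.
have -> : ((i - k) %% 3 = 2)%N; last by [].
by move: dvd3 => /dvdnP[c Ec]; lia.
Qed.

Lemma a_gen_cube (R : comNzRingType) (k l n : nat) :
  exists q : {poly R},
    (a (3 * l + 5) (3 * k + 1) n)%:R = (q ^+ 3 * gauss_sum R n)`_n.
Proof.
pose go := geom_prod R odd n; pose ge := geom_prod R (predC odd) n.
pose uo := poch R odd n; pose ue := poch R (predC odd) n.
(* As 3k+1 = 3(k+1) - 2 and 3l+5 = 3(l+2) - 1, the cube has surplus [go ^+ 2 * ge], which
   [uo ^+ 2 * ue] cancels. *)
exists (go ^+ k.+1 * ge ^+ l.+2); rewrite a_coef.
apply: (@eqX_coef _ n.+1) => //; apply: eqX_sym.
apply: (eqX_trans (q := (go ^+ k.+1 * ge ^+ l.+2) ^+ 3 * (uo ^+ 2 * ue))).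
  by apply: eqXM; [exact: eqX_refl | exact: gauss_product].
have -> : (go ^+ k.+1 * ge ^+ l.+2) ^+ 3 * (uo ^+ 2 * ue)
    = go ^+ (3 * k + 1) * ge ^+ (3 * l + 5) * ((go * uo) ^+ 2 * (ge * ue)).
  rewrite [go ^+ k.+1]exprS [ge ^+ l.+2]exprS [ge ^+ l.+1]exprS (exprD go) (exprD ge (3 * l)).
  by rewrite !(mulnC 3) !exprM; ring.
rewrite -[X in eqX _ _ X]mulr1; apply: eqXM; first exact: eqX_refl.
rewrite -[1]mulr1; apply: eqXM; last exact: geom_prodK.
by rewrite -[1](expr1n _ 2); apply: eqX_exp; exact: geom_prodK.
Qed.

Local Close Scope ring_scope.

Theorem theorem1p10 (n k j : nat) (hjk : j <= k) :
  a (3 * (k - j) + 5) (3 * k + 1) (3 * n + 2) = 0 %[mod 3].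
Proof.
(* Divisibility by 3 is vanishing of the image in ['F_3]. *)
have char3 : 3 \in [pchar 'F_3]%R by exact: pchar_Fp.
have [q aE] := a_gen_cube 'F_3 k (k - j) (3 * n + 2).
apply/eqP; rewrite mod0n -/(dvdn 3 _) (dvdn_pcharf char3) aE.
by rewrite coef_cube_gauss_sum //; lia.
Qed.
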